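(* Let $K$ be a field, $S=K[y_1,\dots,y_s]$ the standard graded polynomial ring, $I\subset S$ a homogeneous ideal, and $\prec$ a term order on $S$. Let $\{\mathbf{y}^{\mathbf{a}^{(1)}},\dots,\mathbf{y}^{\mathbf{a}^{(r)}}\}$, with $\mathbf{a}^{(i)}=(a_{i1},\dots,a_{is})\in\mathbb{N}^s$, be the minimal system of monomial generators of the initial ideal $\mathrm{in}_\prec(I)$. Let $d$ be a positive integer. If $$d\ge \frac{s\left(\max\{a_{ij}\mid 1\le i\le r,\ 1\le j\le s\}+1\right)}{2},$$ then the ideal $\phi_d^{-1}(I)$ of $R^{[d]}$ admits a quadratic Gröbner basis.
   Context: $\mathbb{N}=\{0,1,2,\dots\}$; for $\mathbf{a}=(a_1,\dots,a_s)\in\mathbb{N}^s$, $\mathbf{y}^{\mathbf{a}}=y_1^{a_1}\cdots y_s^{a_s}$ and $|\mathbf{a}|=a_1+\dots+a_s$; $\mathbb{N}^s_d=\{\mathbf{a}\in\mathbb{N}^s\mid|\mathbf{a}|=d\}$. $R^{[d]}=K[x_{\mathbf{a}}\mid\mathbf{a}\in\mathbb{N}^s_d]$ is the (standard graded) polynomial ring whose variables correspond to the monomials of degree $d$ in $S$, and $\phi_d:R^{[d]}\to S$ is the $K$-algebra homomorphism with $\phi_d(x_{\mathbf{a}})=\mathbf{y}^{\mathbf{a}}$. A homogeneous ideal admits a quadratic Gröbner basis if, with respect to some term order, it has a Gröbner basis consisting of homogeneous polynomials of degree at most $2$. *)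

(* Defs.v *)
From mathcomp Require Import all_boot all_order all_algebra.
From mathcomp Require Import mpoly.

Set Implicit Arguments.
Unset Strict Implicit.
Unset Printing Implicit Defensive.

Import GRing.Theory.
Local Open Scope ring_scope.

(* Ideals are Prop-valued predicates; unlike ring_quotient's [idealr], the unit
   ideal is allowed and membership need not be decidable. *)
Definition is_ideal (A : comNzRingType) (I : A -> Prop) : Prop :=
  [/\ I 0,
      forall p q, I p -> I q -> I (p + q)
    & forall p q, I q -> I (p * q)].

Definition ideal_span (A : comNzRingType) (G : A -> Prop) (p : A) : Prop :=
  forall J : A -> Prop, is_ideal J -> (forall g, G g -> J g) -> J p.

Definition homogeneous_ideal (K : fieldType) (n : nat)
    (I : {mpoly K[n]} -> Prop) : Prop :=
  is_ideal I /\ forall p e, I p -> I (pihomog mdeg e p).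

(* [ord a b] reads "y^a is at most y^b". *)
Definition term_order (n : nat) (ord : rel 'X_{1..n}) : Prop :=
  [/\ total ord, antisymmetric ord, transitive ord,
      forall a, ord 0%MM a
    & forall a b c, ord a b -> ord (a + c)%MM (b + c)%MM].

Definition initial_monomial (K : fieldType) (n : nat) (ord : rel 'X_{1..n})
    (p : {mpoly K[n]}) (a : 'X_{1..n}) : Prop :=
  a \in msupp p /\ {in msupp p, forall b, ord b a}.

(* The zero polynomial has no initial monomial, so it contributes nothing. *)
Definition initial_monomials (K : fieldType) (n : nat) (ord : rel 'X_{1..n})
    (F : {mpoly K[n]} -> Prop) (q : {mpoly K[n]}) : Prop :=
  exists p a, [/\ F p, initial_monomial ord p a & q = 'X_[a]].

Definition initial_ideal (K : fieldType) (n : nat) (ord : rel 'X_{1..n})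
    (I : {mpoly K[n]} -> Prop) : {mpoly K[n]} -> Prop :=
  ideal_span (initial_monomials ord I).

Definition monomials_generate (K : fieldType) (n : nat)
    (gens : seq 'X_{1..n}) (J : {mpoly K[n]} -> Prop) : Prop :=
  forall p, J p <-> ideal_span (fun q => exists2 a, a \in gens & q = 'X_[a]) p.

Definition minimal_monomial_generators (K : fieldType) (n : nat)
    (gens : seq 'X_{1..n}) (J : {mpoly K[n]} -> Prop) : Prop :=
  [/\ uniq gens, monomials_generate gens J
    & forall gens' : seq 'X_{1..n}, {subset gens' <= gens} ->
        monomials_generate gens' J -> {subset gens <= gens'}].

Definition groebner_basis (K : fieldType) (n : nat) (ord : rel 'X_{1..n})
    (I : {mpoly K[n]} -> Prop) (G : seq {mpoly K[n]}) : Prop :=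
  [/\ 0 \notin G,
      forall g, g \in G -> I g
    & forall p, initial_ideal ord I p <->
        ideal_span (initial_monomials ord (fun g => g \in G)) p].

Definition admits_quadratic_groebner_basis (K : fieldType) (n : nat)
    (I : {mpoly K[n]} -> Prop) : Prop :=
  exists (ord : rel 'X_{1..n}) (G : seq {mpoly K[n]}),
    [/\ term_order ord, groebner_basis ord I G
      & forall g, g \in G -> exists2 e : nat, (e <= 2)%N & g \is e.-homog].

(* The exponent vectors of degree d, carved out of the finite type
   'X_{1..s < d.+1} of exponent vectors of degree at most d. *)
Definition exponents_of_degree (s d : nat) : {set 'X_{1..s < d.+1}} :=
  [set a : 'X_{1..s < d.+1} | mdeg a == d].

(* The polynomial ring in the variables x_a, where the k-th variable stands for
   x_a with a the k-th element of [exponents_of_degree s d]. *)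
Definition veronese_ring (K : fieldType) (s d : nat) :=
  {mpoly K[#|exponents_of_degree s d|]}.

Definition veronese_map (K : fieldType) (s d : nat)
    (f : veronese_ring K s d) : {mpoly K[s]} :=
  f \mPo [tuple 'X_[(enum_val k : 'X_{1..s < d.+1})]
         | k < #|exponents_of_degree s d|].

(* Main.v *)
(** Put [e = ceil (m / 2)], where [m] is the largest exponent of a generator of
    the initial ideal, so that [s * e <= d].  Call a product of two variables
    [x_b x_b'] standard if it is the heaviest monomial with its image in S, for
    a weight which gives the largest value to the vectors [b] that contain as
    many as possible of the first [e] units of every coordinate, and then as
    many as possible of the first coordinates.  If all the quadratic divisors of
    a monomial [w] are standard, an exchange argument shows that the heaviest
    factor of [w] is the greedy divisor of the image [u] of [w]; hence [w] is
    determined by [u], and it is the smallest monomial with image [u] for the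
    term order that compares images first and then prefers heavy monomials.
    Each of the two heaviest factors of [w] contains the first [e] available
    units of every coordinate, so their product has exponents at least
    [min (u_l) (2 e)] and its image is divisible by every generator of the
    initial ideal that divides [u].  So an initial monomial is divisible either
    by the leading term of a quadratic binomial in the kernel, or by a monomial
    of degree at most 2 whose image lies in the initial ideal; homogeneous
    elements of I lift, by lifting their monomials one by one. *)

Require Import Defs.
From mathcomp Require Import all_boot all_order all_algebra.
From mathcomp Require Import mpoly.
From mathcomp Require Import zify lra.
From Stdlib Require Import Classical.

Set Implicit Arguments.
Unset Strict Implicit.
Unset Printing Implicit Defensive.

(** * Exchanges and greedy divisors of exponent vectors *)

Section ExponentVectors.

Variable s : nat.
Implicit Types b u v : 'X_{1..s}.

Lemma exists_le_mdeg v d :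
  (d <= mdeg v)%N -> exists2 b, (b <= v)%MM & mdeg b = d.
Proof.
elim: d => [|d IHd] dv.
  by exists 0%MM; rewrite ?mdeg0 //; apply/mnm_lepP => l; rewrite mnm0E.
have [b bv bd] := IHd (ltnW dv).
have vb : (v = (v - b) + b)%MM by rewrite submK.
have: (v - b)%MM != 0%MM.
  by rewrite -mdeg_eq0; have := congr1 (@mdeg s) vb; rewrite mdegD bd; lia.
rewrite -mdeg_eq0 mdegE sum_nat_eq0 negb_forall => /existsP[l].
rewrite implyTb mnmBE => bl; exists (b + U_(l))%MM; last first.
  by rewrite mdegD mdeg1 bd addn1.
apply/mnm_lepP => i; rewrite mnmDE mnm1E.
move/mnm_lepP/(_ i): bv; case: eqP => [<-|_] /=; lia.
Qed.

Lemma mdeg_eq_exists_gt b b' (l : 'I_s) :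
  mdeg b = mdeg b' -> (b l < b' l)%N -> exists l', (b' l' < b l')%N.
Proof.
move=> bb' lt_l; apply/existsP; apply: contraTT lt_l => /existsPn no_gt.
have le i : (b i <= b' i)%N by rewrite leqNgt no_gt.
move: bb'; rewrite !mdegE (bigD1 l) //= [RHS](bigD1 l) //= => bb'.
rewrite -leqNgt -(leq_add2r (\sum_(i < s | i != l) b' i)) -bb'.
by rewrite leq_add2l leq_sum.
Qed.

(** The unit is added before the truncated subtraction, so that [l = l'] gives back [b]. *)
Definition mnm_exchange b (l l' : 'I_s) : 'X_{1..s} := (b + U_(l) - U_(l'))%MM.

Lemma mnm_exchangeE b l l' i :
  mnm_exchange b l l' i = (b i + (l == i) - (l' == i))%N.
Proof. by rewrite mnmBE mnmDE !mnm1E. Qed.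

Lemma mnm_exchangeK b l l' : (0 < b l')%N ->
  (mnm_exchange b l l' + U_(l') = b + U_(l))%MM.
Proof.
move=> b_gt0; rewrite /mnm_exchange submK //; apply/mnm_lepP => i.
by rewrite mnmDE !mnm1E; case: (l' =P i) => [<-|] //=; lia.
Qed.

Lemma mdeg_exchange b l l' : (0 < b l')%N ->
  mdeg (mnm_exchange b l l') = mdeg b.
Proof.
move=> /(mnm_exchangeK l)/(congr1 (@mdeg s)).
by rewrite !mdegD !mdeg1 => /addIn.
Qed.

Lemma mnm_exchangeD b b' l l' : (0 < b l')%N -> (0 < b' l)%N ->
  (mnm_exchange b l l' + mnm_exchange b' l' l = b + b')%MM.
Proof.
move=> bl' b'l; apply/mnmP => i; rewrite !mnmDE !mnm_exchangeE.
case: (l' =P i) => [<-|] //=; case: (l =P _) => [E|] //=; rewrite -?E; lia.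
Qed.

Variable e : nat.

(* The first [e] units of a coordinate are worth more than any further unit;
   among the latter, those of early coordinates are worth more. *)
Definition gain (l : 'I_s) (t : nat) : nat :=
  minn t e * s.+1 + (t - e) * (s - l).

Definition preference b : nat := \sum_(l < s) gain l (b l).

(** The unit taken from [l'] lies above [e] and is worth [s - l']; at [l] it is worth [s.+1] below
    [e] and [s - l] beyond, which is more in both cases. *)
Lemma preference_exchange b (l l' : 'I_s) :
  (e < b l')%N -> (b l < e)%N || (l < l')%N ->
  (preference b < preference (mnm_exchange b l l'))%N.
Proof.
move=> bl' better; have ll' : l' != l.
  by apply: contraTneq better => E; move: bl'; rewrite E ltnn orbF; lia.
rewrite /preference (bigD1 l) // (bigD1 l') //=.
rewrite [X in (_ < X)%N](bigD1 l) // [X in (_ < _ + X)%N](bigD1 l') //=.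
set r := (\sum_(i < s | _) _)%N; set r' := (\sum_(i < s | _) _)%N.
have -> : r' = r.
  apply: eq_bigr => i /andP[il il']; rewrite mnm_exchangeE.
  by rewrite !(eq_sym _ i) (negbTE il) (negbTE il') addn0 subn0.
rewrite !mnm_exchangeE !eqxx (negbTE ll') (eq_sym l) (negbTE ll').
rewrite !addnA ltn_add2r.
rewrite addn0 subn0 addn1 subn1 /gain.
have ls := ltn_ord l; have ls' := ltn_ord l'.
have E1 : minn (b l').-1 e = e by lia.
have E2 : minn (b l') e = e by lia.
have E3 : (b l' - e = ((b l').-1 - e).+1)%N by lia.
rewrite E1 E2 E3 mulSn.
case: (ltnP (b l) e) better => [ble _|ble /= lt_ll'].
  have -> : minn (b l).+1 e = (minn (b l) e).+1 by lia.
  have -> : ((b l).+1 - e = b l - e)%N by lia.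
  by rewrite mulSn; lia.
have -> : minn (b l).+1 e = minn (b l) e by lia.
have -> : ((b l).+1 - e = (b l - e).+1)%N by lia.
by rewrite mulSn; lia.
Qed.

(* The degree left by the first [e] units of each coordinate is filled with the
   earliest coordinates of [u]. *)
Definition greedy_divisor u b : Prop :=
  [/\ (b <= u)%MM, forall l, (minn (u l) e <= b l)%N
    & forall l l' : 'I_s, (l < l')%N -> (b l < u l)%N -> (b l' <= e)%N].

(** Otherwise, the degrees being equal, each vector exceeds the other somewhere. The one that is
    smaller at the earlier of two such coordinates is not full there, so at the later one it is at
    most [e], hence at most the other vector. *)
Lemma greedy_divisor_uniq u b b' : mdeg b = mdeg b' ->
  greedy_divisor u b -> greedy_divisor u b' -> b = b'.
Proof.
move=> bb' [/mnm_lepP bu core fill] [/mnm_lepP b'u core' fill'].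
have incomparable (l l' : 'I_s) : ~ ((b l < b' l)%N && (b' l' < b l')%N).
  case/andP=> lt_l lt_l'; case: (ltngtP l l') => [ll'|l'l|/val_inj E].
  - have:= fill _ _ ll' (leq_trans lt_l (b'u _)).
    by have := core' l'; have := bu l'; lia.
  - have:= fill' _ _ l'l (leq_trans lt_l' (bu _)).
    by have := core l; have := b'u l; lia.
  - by rewrite E in lt_l; lia.
apply/mnmP => l; apply/eqP; rewrite eqn_leq; apply/andP; split; rewrite leqNgt.
  apply/negP => lt_l; have [l' lt_l'] := mdeg_eq_exists_gt (esym bb') lt_l.
  by apply: (incomparable l' l); rewrite lt_l' lt_l.
apply/negP => lt_l; have [l' lt_l'] := mdeg_eq_exists_gt bb' lt_l.
by apply: (incomparable l l'); rewrite lt_l lt_l'.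
Qed.

End ExponentVectors.

(** * Monomials in the variables x_a and their images in S *)

Section VeroneseMonomials.

Variables (s N d e : nat) (beta : 'I_N -> 'X_{1..s}).
Hypothesis d_gt0 : (0 < d)%N.
Hypothesis le_se_d : (s * e <= d)%N.
Hypothesis mdeg_beta : forall k, mdeg (beta k) = d.
Hypothesis beta_inj : injective beta.
Hypothesis beta_surj : forall b, mdeg b = d -> exists k, beta k = b.
Implicit Types w : 'X_{1..N}.

Definition mnm_image w : 'X_{1..s} := (\sum_(k < N) beta k *+ w k)%MM.

Lemma mnm_imageE w l : mnm_image w l = (\sum_(k < N) beta k l * w k)%N.
Proof. by rewrite mnm_sumE; apply: eq_bigr => k _; rewrite mulmnE. Qed.

Lemma mnm_image0 : mnm_image 0%MM = 0%MM.
Proof.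
apply/mnmP => l; rewrite mnm_imageE mnm0E big1 // => k _.
by rewrite mnm0E muln0.
Qed.

Lemma mnm_imageD w w' : mnm_image (w + w')%MM = (mnm_image w + mnm_image w')%MM.
Proof.
apply/mnmP => l; rewrite mnmDE !mnm_imageE -big_split /=.
by apply: eq_bigr => k _; rewrite mnmDE mulnDr.
Qed.

Lemma mnm_imageU k : mnm_image U_(k)%MM = beta k.
Proof.
apply/mnmP => l; rewrite mnm_imageE (bigD1 k) //=.
rewrite big1 ?mnm1E ?eqxx ?muln1 ?addn0 //.
by move=> i ik; rewrite mnm1E eq_sym (negbTE ik) muln0.
Qed.

Lemma mdeg_mnm_image w : mdeg (mnm_image w) = (d * mdeg w)%N.
Proof.
rewrite mdeg_sum [mdeg w]mdegE big_distrr /=.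
by apply: eq_bigr => k _; rewrite mdegMn mdeg_beta.
Qed.

Lemma mdeg_mnm_image_inj w w' : mnm_image w = mnm_image w' -> mdeg w = mdeg w'.
Proof.
move/(congr1 (@mdeg s)); rewrite !mdeg_mnm_image.
by move/eqP; rewrite eqn_pmul2l // => /eqP.
Qed.

Lemma exists_mnm_image k v : mdeg v = (d * k)%N ->
  exists2 w, mdeg w = k & mnm_image w = v.
Proof.
elim: k v => [|k IHk] v vd.
  exists 0%MM; first exact: mdeg0.
  by rewrite mnm_image0; apply/esym/eqP; rewrite -mdeg_eq0 vd muln0.
have [|b bv bd] := @exists_le_mdeg _ v d; first by rewrite vd mulnS leq_addr.
have vE := submK bv; have [i bE] := beta_surj bd.
have [|w wk wE] := IHk (v - b)%MM.
  by move: vd; rewrite -{1}vE mdegD bd mulnS addnC => /addnI.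
exists (w + U_(i))%MM; first by rewrite mdegD mdeg1 addn1 wk.
by rewrite mnm_imageD wE mnm_imageU bE.
Qed.

Lemma submUK w k : (0 < w k)%N -> ((w - U_(k)) + U_(k) = w)%MM.
Proof. by move=> wk; rewrite submK // lep1mP -lt0n. Qed.

(** Powers of two let one variable weigh at least as much as any two of smaller preference. *)
Definition weight w : nat := \sum_(k < N) w k * 2 ^ preference e (beta k).

Lemma weightD w w' : weight (w + w')%MM = (weight w + weight w')%N.
Proof.
by rewrite -big_split /=; apply: eq_bigr => k _; rewrite mnmDE mulnDl.
Qed.

Lemma weightU k : weight U_(k)%MM = (2 ^ preference e (beta k))%N.
Proof.
rewrite /weight (bigD1 k) //= big1 ?mnm1E ?eqxx ?mul1n ?addn0 //.
by move=> i ik; rewrite mnm1E eq_sym (negbTE ik) mul0n.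
Qed.

Definition fiber_maximal w : Prop :=
  forall w', mnm_image w' = mnm_image w -> (weight w' <= weight w)%N.

(** No quadratic divisor, squares included, leads a binomial of the kernel when heavier monomials
    count as smaller. *)
Definition pairwise_maximal w : Prop :=
  forall k1 k2, (U_(k1) + U_(k2) <= w)%MM -> fiber_maximal (U_(k1) + U_(k2))%MM.

Lemma fiber_maximal_le w w' :
  (w' <= w)%MM -> fiber_maximal w -> fiber_maximal w'.
Proof.
move/submK; move: (w - w')%MM => r <- max_w v vE; have := max_w (r + v)%MM.
by rewrite !mnm_imageD vE !weightD leq_add2l; apply.
Qed.

Lemma fiber_maximal_pairwise w : fiber_maximal w -> pairwise_maximal w.
Proof. by move=> max_w k1 k2 /fiber_maximal_le; apply. Qed.

Lemma pairwise_maximal_le w w' :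
  (w' <= w)%MM -> pairwise_maximal w -> pairwise_maximal w'.
Proof. by move=> w'w pw k1 k2 /lepm_trans/(_ w'w); apply: pw. Qed.

Definition preferred_factor w k : Prop := (0 < w k)%N /\
  forall i, (0 < w i)%N -> (preference e (beta i) <= preference e (beta k))%N.

Lemma exists_preferred w : w != 0%MM -> exists k, preferred_factor w k.
Proof.
rewrite -mdeg_eq0 mdegE sum_nat_eq0 negb_forall => /existsP[k0].
rewrite implyTb -lt0n => wk0.
pose P k := (0 < w k)%N.
pose F k := preference e (beta k).
by case: (arg_maxnP (P := P) F wk0) => k; exists k.
Qed.

(* Exchanging units between [beta k] and another factor of [w] would
   otherwise produce a variable whose weight alone exceeds that of the pair. *)
Lemma preferred_exchange w k : pairwise_maximal w ->
    preferred_factor w k ->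
  forall l l' : 'I_s, (beta k l < mnm_image w l)%N ->
    (e < beta k l')%N -> ~~ ((beta k l < e)%N || (l < l')%N).
Proof.
move=> pw [wk best] l l' ltu lte; apply/negP => better.
have wE := submUK wk.
(* The image exceeds [beta k] at [l], so some other factor contributes a unit there. *)
have [k2 k2l] : exists k2, (0 < beta k2 l * (w - U_(k))%MM k2)%N.
  apply/existsP; apply: contraT => /existsPn all0.
  move: ltu; rewrite -wE mnm_imageD mnm_imageU mnmDE mnm_imageE big1 ?ltnn //.
  by move=> i _; apply/eqP; rewrite -leqn0 leqNgt all0.
move: k2l; rewrite muln_gt0 => /andP[k2l wk2].
have pair_le : (U_(k) + U_(k2) <= w)%MM.
  rewrite -wE addmC; apply/mnm_lepP => i; rewrite !mnmDE leq_add2r mnm1E.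
  by case: eqP => [<-|].
have l'_gt0 : (0 < beta k l')%N by lia.
(* Swapping a unit of [l'] in [beta k] for a unit of [l] in [beta k2] keeps the image of the
   pair. *)
have [j1 j1E] := beta_surj (etrans (mdeg_exchange l l'_gt0) (mdeg_beta k)).
have [j2 j2E] := beta_surj (etrans (mdeg_exchange l' k2l) (mdeg_beta k2)).
have := pw _ _ pair_le (U_(j1) + U_(j2))%MM.
rewrite !mnm_imageD !mnm_imageU j1E j2E mnm_exchangeD // => /(_ erefl).
rewrite !weightD !weightU j1E leqNgt => /negP; apply.
have le1 := preference_exchange lte better.
have wk2' : (0 < w k2)%N by move: wk2; rewrite mnmBE; lia.
have := best _ wk2'; rewrite -(@leq_exp2l 2) // => le2.
move: le1; rewrite -(@leq_exp2l 2) // expnS => le1.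
by have := expn_gt0 2 (preference e (beta j2)); lia.
Qed.

Lemma preferred_greedy w k : pairwise_maximal w ->
  preferred_factor w k -> greedy_divisor e (mnm_image w) (beta k).
Proof.
move=> pw wk; have exch := preferred_exchange pw wk; split.
- by rewrite -{1}(submUK wk.1) mnm_imageD mnm_imageU lem_addl.
- move=> l; rewrite leqNgt; apply/negP; rewrite leq_min => /andP[ltu lte].
  suff [l' lt_l'] : exists l', (e < beta k l')%N.
    by have /negP[] := exch _ _ ltu lt_l'; rewrite lte.
  (* If no coordinate exceeded [e], the deficit at [l] would push the degree of [beta k] below
     [s * e]. *)
  apply/existsP; apply: contraT => /existsPn small.
  move: le_se_d; rewrite -(mdeg_beta k) mdegE leqNgt => /negP[].
  have -> : (s * e = \sum_(i < s) e)%N by rewrite sum_nat_const card_ord.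
  rewrite (bigD1 l) //= [X in (_ < X)%N](bigD1 l) //=.
  by rewrite -addSn leq_add // leq_sum // => i _; rewrite leqNgt small.
- move=> l l' ll' ltu; rewrite leqNgt; apply/negP => lte.
  by have /negP[] := exch _ _ ltu lte; rewrite ll' orbT.
Qed.

(** Induction on the degree: in both monomials a preferred factor is the greedy divisor of the
    common image, so it can be cancelled. *)
Lemma pairwise_maximal_uniq w w' : pairwise_maximal w -> pairwise_maximal w' ->
  mnm_image w = mnm_image w' -> w = w'.
Proof.
have [n] := ubnP (mdeg w); elim: n w w' => // n IHn w w' lt_wn pw pw' ww'.
have dww' := mdeg_mnm_image_inj ww'.
have [w0|wN0] := eqVneq w 0%MM.
  by apply/esym/eqP; rewrite w0 -mdeg_eq0 -dww' w0 mdeg0.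
have w'N0 : w' != 0%MM by rewrite -mdeg_eq0 -dww' mdeg_eq0.
have [k pk] := exists_preferred wN0; have wk := pk.1.
have [k' pk'] := exists_preferred w'N0; have wk' := pk'.1.
have gk := preferred_greedy pw pk.
have gk' := preferred_greedy pw' pk'; rewrite -ww' in gk'.
have /beta_inj E : beta k = beta k'.
  by apply: greedy_divisor_uniq gk gk'; rewrite !mdeg_beta.
rewrite -(submUK wk) -(submUK wk') E; congr (_ + _)%MM; rewrite -E.
apply: IHn.
- by move: lt_wn; rewrite -{1}(submUK wk) mdegD mdeg1 addn1.
- exact: pairwise_maximal_le (lem_subr _ _) pw.
- exact: pairwise_maximal_le (lem_subr _ _) pw'.
- have:= ww'; rewrite -{1}(submUK wk) -{1}(submUK wk') -E !mnm_imageD.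
  exact: addIm.
Qed.

(** The image fixes the degree, so the fiber is finite and has a heaviest element, which is [w] by
    uniqueness. An equally heavy [w'] would also be maximal, hence equal to [w]. *)
Lemma pairwise_maximal_gt w w' : pairwise_maximal w ->
  mnm_image w' = mnm_image w -> w' != w -> (weight w' < weight w)%N.
Proof.
move=> pw w'w; apply: contraNT; rewrite -leqNgt => le_w.
have small v : mnm_image v = mnm_image w -> (mdeg v < (mdeg w).+1)%N.
  by move/mdeg_mnm_image_inj ->.
pose P (v : 'X_{1..N < (mdeg w).+1}) := mnm_image v == mnm_image w.
have Pw : P (BMultinom (small _ erefl)) by rewrite /P.
case: (arg_maxnP (P := P) weight Pw) => v /eqP vw max_v.
have max_v' v' : mnm_image v' = mnm_image w -> (weight v' <= weight v)%N.
  by move=> v'w; apply: (max_v (BMultinom (small _ v'w))); apply/eqP.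
have Ev : val v = w.
  apply: pairwise_maximal_uniq => //; apply: fiber_maximal_pairwise => v'.
  by rewrite vw => /max_v'.
apply/eqP; apply: pairwise_maximal_uniq => //.
apply: fiber_maximal_pairwise => v'.
by rewrite w'w => /max_v'; rewrite Ev => /leq_trans; apply.
Qed.

(** Split off a preferred factor twice. The second is greedy for what the first leaves of the image,
    so together they contain the first [2 e] available units. *)
Lemma pairwise_maximal_quadratic_divisor w : pairwise_maximal w ->
  exists w', [/\ (w' <= w)%MM, (mdeg w' <= 2)%N
    & forall l, (minn (mnm_image w l) e.*2 <= mnm_image w' l)%N].
Proof.
move=> pw; have [w0|wN0] := eqVneq w 0%MM.
  by exists w; rewrite lepm_refl w0 mdeg0; split=> // l; rewrite geq_minl.
have [k pk] := exists_preferred wN0.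
have wE := submUK pk.1; set v := (w - U_(k))%MM in wE.
have [v0|vN0] := eqVneq v 0%MM.
  exists w; split=> [||l]; rewrite ?lepm_refl ?geq_minl //.
  by rewrite -wE v0 mdegD mdeg0 mdeg1.
have pv : pairwise_maximal v := pairwise_maximal_le (lem_subr _ _) pw.
have [k2 pk2] := exists_preferred vN0.
have [_ core _] := preferred_greedy pw pk.
have [_ core2 _] := preferred_greedy pv pk2.
exists (U_(k) + U_(k2))%MM; split; last 2 first.
- by rewrite mdegD !mdeg1.
- move=> l; move: (core l) (core2 l).
  rewrite -wE !mnm_imageD !mnm_imageU !mnmDE.
  lia.
- rewrite -wE addmC; apply/mnm_lepP => i; rewrite !mnmDE leq_add2r mnm1E.
  by case: eqP => [<-|] //; apply: pk2.1.
Qed.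

End VeroneseMonomials.

Import GRing.Theory.
Local Open Scope ring_scope.

(** * Ideal spans, initial monomials and Groebner bases *)

Section Ideals.

Variable A : comNzRingType.
Implicit Types G H : A -> Prop.

Lemma ideal_span_is_ideal G : is_ideal (ideal_span G).
Proof.
split=> [J [] //|p q Gp Gq J idJ GJ|p q Gq J idJ GJ].
  by case: (idJ) => _ addJ _; apply: addJ; [apply: Gp | apply: Gq].
by case: (idJ) => _ _ mulJ; apply: mulJ; apply: Gq.
Qed.

Lemma sub_ideal_span G g : G g -> ideal_span G g.
Proof. by move=> Gg J _; apply. Qed.

Lemma ideal_span_sub G H : (forall g, G g -> ideal_span H g) ->
  forall p, ideal_span G p -> ideal_span H p.
Proof. by move=> GH p; apply=> //; apply: ideal_span_is_ideal. Qed.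

End Ideals.

Section Monomials.

Variables (K : fieldType) (n : nat).
Implicit Types p q : {mpoly K[n]}.

Lemma mpolyX_ideal_span (G : {mpoly K[n]} -> Prop) (a b : 'X_{1..n}) :
  G 'X_[a] -> (a <= b)%MM -> ideal_span G 'X_[b].
Proof.
move=> Ga /submK <-; rewrite mpolyXD.
by case: (ideal_span_is_ideal G) => _ _; apply; apply: sub_ideal_span.
Qed.

(** The polynomials all of whose monomials have a divisor in [M] form an ideal containing [G]. *)
Lemma ideal_span_mpolyX (G : {mpoly K[n]} -> Prop) (M : 'X_{1..n} -> Prop) v :
    (forall q, G q -> exists2 a, M a & q = 'X_[a]) -> ideal_span G 'X_[v] ->
  exists2 a, M a & (a <= v)%MM.
Proof.
move=> GM /(_ (fun p => {in msupp p, forall m, exists2 a, M a & (a <= m)%MM})).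
apply; last 2 first.
- move=> _ /GM[a Ma ->] m; rewrite msuppX inE => /eqP->.
  by exists a; rewrite ?lepm_refl.
- by rewrite msuppX inE.
split=> [m|p q pM qM m /msuppD_le|p q qM m /msuppM_le];
  last case/allpairsP=> [[m1 m2] /= [_ /qM]].
- by rewrite msupp0.
- by rewrite mem_cat => /orP[/pM|/qM].
- by case=> a Ma am2 ->; exists a => //; apply: lepm_trans am2 (lem_addl _ _).
Qed.

Lemma mem_msupp_pihomog (e : nat) p m :
  (m \in msupp (pihomog mdeg e p)) = (mdeg m == e) && (m \in msupp p).
Proof.
rewrite pihomogE -big_filter (perm_mem (msupp_sumX _ _)) ?mem_filter //.
  by rewrite filter_uniq ?msupp_uniq.
by move=> a; rewrite mem_filter mcoeff_msupp => /andP[].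
Qed.

Variable ord : rel 'X_{1..n}.
Hypothesis ord_term : term_order ord.

Lemma term_order_refl : reflexive ord.
Proof. by case: ord_term => tot _ _ _ _ a; have := tot a a; rewrite orbb. Qed.

Lemma initial_monomialM p a c :
  initial_monomial ord p a -> initial_monomial ord (p * 'X_[c]) (a + c)%MM.
Proof.
case: ord_term => _ _ _ _ mono [ap max_a]; split=> [|b].
  by rewrite (perm_mem (msuppMX _ _)) addmC map_f.
rewrite (perm_mem (msuppMX _ _)) => /mapP[b' /max_a le_b' ->].
by rewrite addmC mono.
Qed.

Lemma initial_monomial_pihomog p a :
  initial_monomial ord p a -> initial_monomial ord (pihomog mdeg (mdeg a) p) a.
Proof.
case=> ap max_a; split=> [|b]; first by rewrite mem_msupp_pihomog eqxx.
by rewrite mem_msupp_pihomog => /andP[_ /max_a].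
Qed.

(** Multiply an element of [I] whose initial monomial divides [a] up to [b], then take the component
    of degree [mdeg b]. *)
Lemma initial_ideal_homog (I : {mpoly K[n]} -> Prop) a b :
    homogeneous_ideal I -> initial_ideal ord I 'X_[a] -> (a <= b)%MM ->
  exists q, [/\ I q, q \is (mdeg b).-homog & initial_monomial ord q b].
Proof.
case=> [[_ _ mulI] homI] Ia ab.
have [c [p Ip pc] ca] : exists2 c,
    (exists2 p, I p & initial_monomial ord p c) & (c <= a)%MM.
  apply: ideal_span_mpolyX Ia => _ [p [c [Ip pc ->]]].
  by exists c => //; exists p.
have bE := submK (lepm_trans ca ab).
exists (pihomog mdeg (mdeg b) (p * 'X_[b - c])); split; last 1 first.
- apply: initial_monomial_pihomog.
  by rewrite -{2}bE addmC; apply: initial_monomialM.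
- by apply: homI; rewrite mulrC; apply: mulI.
- exact: pihomogP.
Qed.

(** Finitely many monomials have degree at most [D]; one polynomial is chosen for each that occurs
    as an initial monomial, which excluded middle decides. *)
Lemma exists_groebner_basis (J : {mpoly K[n]} -> Prop) (D : nat) :
    (forall p a, J p -> initial_monomial ord p a ->
       exists g b e, [/\ J g, (e <= D)%N, g \is e.-homog,
                       initial_monomial ord g b & (b <= a)%MM]) ->
  exists2 G, groebner_basis ord J G &
    forall g, g \in G -> exists2 e : nat, (e <= D)%N & g \is e.-homog.
Proof.
move=> reduce.
pose good g b := [/\ J g, exists2 e : nat, (e <= D)%N & g \is e.-homog
                   & initial_monomial ord g b].
have [G Ggood Gall] : exists2 G : seq {mpoly K[n]},
    forall g, g \in G -> exists b, good g b &
    forall b : 'X_{1..n < D.+1}, (exists g, good g b) ->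
      exists2 g, g \in G & initial_monomial ord g b.
  suff: forall bs : seq 'X_{1..n < D.+1}, exists2 G : seq {mpoly K[n]},
      forall g, g \in G -> exists b, good g b &
      forall b : 'X_{1..n < D.+1}, b \in bs -> (exists g, good g b) ->
        exists2 g, g \in G & initial_monomial ord g b.
    move=> /(_ (enum {: 'X_{1..n < D.+1}}))[G Gg Gall]; exists G => // b.
    by apply: Gall; rewrite mem_enum.
  elim=> [|b bs [G Gg Gall]]; first by exists [::].
  have [[g gb]|none] := classic (exists g, good g b).
    exists (g :: G) => [h|c]; rewrite inE => /predU1P[->|].
    - by exists (val b).
    - exact: Gg.
    - by move=> _; exists g; [rewrite mem_head | case: gb].
    - by move=> /Gall cG /cG[h hG hc]; exists h => //; rewrite inE hG orbT.
  by exists G => // c; rewrite inE => /predU1P[->|]; [move/none | apply: Gall].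
exists G; last by move=> g /Ggood[b []].
split=> [|g /Ggood[b []] //|p].
  by apply/negP => /Ggood[b [_ _ []]]; rewrite msupp0.
split; apply: ideal_span_sub => _ [q [a [Jq qa ->]]]; last first.
  apply: sub_ideal_span; exists q, a; split=> //.
  by have [b []] := Ggood _ Jq.
have [g [b [e [Jg eD ge gb ba]]]] := reduce _ _ Jq qa.
have bD : (mdeg b < D.+1)%N by case: gb => /(dhomog_mf ge) -> _.
have [|h hG hb] := Gall (BMultinom bD); first by exists g; split=> //; exists e.
by apply: mpolyX_ideal_span ba; exists h, b.
Qed.

End Monomials.

(** * The term order on the Veronese ring and lifting of polynomials *)

Section VeronesePolynomials.

Variables (K : fieldType) (s N d e : nat) (beta : 'I_N -> 'X_{1..s}).
Hypothesis d_gt0 : (0 < d)%N.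
Hypothesis le_se_d : (s * e <= d)%N.
Hypothesis mdeg_beta : forall k, mdeg (beta k) = d.
Hypothesis beta_inj : injective beta.
Hypothesis beta_surj : forall b, mdeg b = d -> exists k, beta k = b.
Variable ord : rel 'X_{1..s}.
Hypothesis ord_term : term_order ord.

Local Notation image := (mnm_image beta).
Local Notation weight := (weight e beta).

(** [veronese_map] for an abstract enumeration [beta] of the vectors of degree [d]. *)
Definition beta_map (p : {mpoly K[N]}) : {mpoly K[s]} :=
  p \mPo [tuple 'X_[beta k] | k < N].

Lemma beta_mapX w : beta_map 'X_[w] = 'X_[image w].
Proof.
rewrite /beta_map comp_mpolyX -mprodXnE.
by apply: eq_bigr => k _; rewrite tnth_mktuple.
Qed.

Lemma beta_mapE p : beta_map p = \sum_(w <- msupp p) p@_w *: 'X_[image w].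
Proof.
rewrite {1}[p]mpolyE /beta_map raddf_sum /=.
by apply: eq_bigr => w _; rewrite comp_mpolyZ -beta_mapX.
Qed.

Lemma msupp_beta_map p v : v \in msupp (beta_map p) ->
  exists2 w, w \in msupp p & image w = v.
Proof.
rewrite beta_mapE => /msupp_sum_le/flattenP[vs /mapP[w]].
rewrite filter_predT => wp -> /msuppZ_le.
by rewrite msuppX inE => /eqP ->; exists w.
Qed.

(* The variables are compared through [image] first, so that [beta_map]
   preserves initial monomials; on each fiber of [image] the heaviest monomial
   is the smallest. *)
Definition veronese_order (w w' : 'X_{1..N}) : bool :=
  if image w == image w' then
    (weight w' < weight w)%N || (weight w == weight w') && (w <= w')%O
  else ord (image w) (image w').

Lemma veronese_order_image w w' :
  veronese_order w w' -> ord (image w) (image w').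
Proof.
rewrite /veronese_order; case: eqP => // -> _.
exact: term_order_refl ord_term _.
Qed.

Lemma veronese_order_term : term_order veronese_order.
Proof.
case: (ord_term) => tot anti trans pos mono; split.
- move=> w w'; rewrite /veronese_order eq_sym; case: eqP => _; last exact: tot.
  case: ltngtP => //= _; exact: Order.TotalTheory.le_total.
- move=> w w'; rewrite /veronese_order eq_sym.
  case: eqP => [_|ne] => [|/anti /esym //].
  by case: ltngtP => //= _ /Order.POrderTheory.le_anti.
- move=> w2 w1 w3 h12 h23.
  have o12 := veronese_order_image h12; have o23 := veronese_order_image h23.
  rewrite /veronese_order; case: eqP => [E|_]; last exact: trans o12 o23.
  have E12 : image w1 = image w2 by apply: anti; rewrite o12 E o23.
  move: h12 h23; rewrite /veronese_order -E E12 !eqxx.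
  case/orP=> [lt12|/andP[/eqP W12 le12]];
    case/orP=> [lt23|/andP[/eqP W23 le23]].
  + by rewrite (ltn_trans lt23 lt12).
  + by rewrite -W23 lt12.
  + by rewrite W12 lt23.
  + by rewrite W12 W23 eqxx (Order.POrderTheory.le_trans le12 le23) orbT.
- move=> w; rewrite /veronese_order mnm_image0.
  case: eqP => [E|_]; last exact: pos.
  (* Although heavy monomials come first, 1 is still the least: it is alone in its fiber. *)
  suff -> : w = 0%MM by rewrite eqxx Order.POrderTheory.lexx orbT.
  apply/eqP; rewrite -mdeg_eq0.
  rewrite -(mdeg_mnm_image_inj d_gt0 mdeg_beta (w := 0%MM)) ?mdeg0 //.
  by rewrite mnm_image0.
- move=> w w' c; rewrite /veronese_order !mnm_imageD eqm_add2r !weightD.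
  by rewrite ltn_add2r eqn_add2r lemc_add2l; case: eqP => // _; apply: mono.
Qed.

(** The term at [image w] cannot cancel: any other monomial of that fiber is strictly lighter, hence
    larger than [w] and absent from [p]. *)
Lemma initial_beta_map p w : pairwise_maximal e beta w ->
  initial_monomial veronese_order p w ->
  initial_monomial ord (beta_map p) (image w).
Proof.
move=> pw [wp max_w]; split=> [|v /msupp_beta_map[w' w'p <-]]; last first.
  exact: veronese_order_image (max_w _ w'p).
rewrite mcoeff_msupp beta_mapE raddf_sum (bigD1_seq w) ?msupp_uniq //=.
rewrite big1_seq ?addr0 ?mcoeffZ ?mcoeffX ?eqxx ?mulr1 -?mcoeff_msupp //.
move=> w' /andP[w'w /max_w w'_le]; rewrite mcoeffZ mcoeffX.
case: eqP => [E|_]; last by rewrite mulr0.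
have := pairwise_maximal_gt d_gt0 le_se_d mdeg_beta beta_inj beta_surj pw E w'w.
move: w'_le; rewrite /veronese_order E eqxx.
by case: ltngtP => //= ->; rewrite ltnn.
Qed.

(** Lift each monomial to a chosen preimage, and [image w] to [w] itself. Then [w] is the only
    monomial of the lift in its fiber, and the others are compared by their images. *)
Lemma exists_beta_map_lift q w : q \is (d * mdeg w).-homog ->
    initial_monomial ord q (image w) ->
  exists p, [/\ beta_map p = q, p \is (mdeg w).-homog
              & initial_monomial veronese_order p w].
Proof.
move=> hq [wq max_w].
have [f fP] : exists f : 'X_{1..s < (d * mdeg w).+1} -> 'X_{1..N},
    forall m : 'X_{1..s < (d * mdeg w).+1}, mdeg m = (d * mdeg w)%N ->
      [/\ image (f m) = m, mdeg (f m) = mdeg w & val m = image w -> f m = w].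
  apply: (fin_all_exists (P := fun (m : 'X_{1..s < (d * mdeg w).+1}) w' =>
    mdeg m = (d * mdeg w)%N -> [/\ image w' = m, mdeg w' = mdeg w
                                 & val m = image w -> w' = w])) => m.
  have [->|mw] := eqVneq (val m) (image w); first by exists w.
  have [/exists_mnm_image|] := eqVneq (mdeg m) (d * mdeg w)%N; last first.
    (* Nothing is required in other degrees; [w] is a default value. *)
    by move=> /eqP dm; exists w.
  case/(_ _ _ beta_surj) => w' dw' w'm; exists w'; split=> // /eqP.
  by rewrite (negbTE mw).
pose p := \sum_(m : 'X_{1..s < (d * mdeg w).+1}) q@_m *: 'X_[f m].
have pE : beta_map p = q.
  rewrite [RHS](@mpolywE _ _ (d * mdeg w).+1); last first.
    rewrite msizeE; apply/bigmax_leqP_seq => m mq _.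
    by rewrite (dhomog_mf hq mq).
  rewrite /beta_map raddf_sum; apply: eq_bigr => m _ /=.
  rewrite comp_mpolyZ -/(beta_map _) beta_mapX.
  have [/fP[-> //]|dm] := eqVneq (mdeg m) (d * mdeg w)%N.
  by rewrite (dhomog_nemf_coeff hq dm) !scale0r.
have supp_p w' : w' \in msupp p ->
    [/\ image w' \in msupp q, mdeg w' = mdeg w & image w' = image w -> w' = w].
  move/msupp_sum_le/flattenP => [vs /mapP[m]] _ -> w'm.
  have mq : val m \in msupp q.
    apply: contraTT w'm; rewrite -mcoeff_eq0 => /eqP ->.
    by rewrite scale0r msupp0.
  have [im df eqf] := fP m (dhomog_mf hq mq).
  by move/msuppZ_le: w'm; rewrite msuppX inE => /eqP ->; rewrite im.
exists p; split=> //; first by apply/dhomogP => w' /supp_p[].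
split.
  move: wq; rewrite -pE => /msupp_beta_map[w' w'p E].
  by case: (supp_p _ w'p) => _ _ <-.
move=> w' /supp_p[/max_w le_w' _ eqw].
have [/eqw ->|ne] := eqVneq (image w') (image w).
  exact: term_order_refl veronese_order_term _.
by rewrite /veronese_order (negbTE ne).
Qed.

(** Within a fiber the lighter monomial is the larger one, so it leads. *)
Lemma initial_binomial w w' (g := 'X_[w] - 'X_[w'] : {mpoly K[N]}) :
    image w' = image w -> (weight w < weight w')%N ->
  [/\ beta_map g = 0, g \is (mdeg w).-homog
    & initial_monomial veronese_order g w].
Proof.
rewrite /g => E lt_w.
have ne : w' == w = false by apply: contraTF lt_w => /eqP ->; rewrite ltnn.
split.
- by rewrite /beta_map raddfB /= -!/(beta_map _) !beta_mapX E subrr.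
- by rewrite rpredB // dhomogX //= (mdeg_mnm_image_inj d_gt0 mdeg_beta E).
split; first by rewrite mcoeff_msupp mcoeffB !mcoeffX eqxx ne subr0 oner_eq0.
move=> v /msuppB_le; rewrite mem_cat !msuppX !inE => /orP[]/eqP->.
  exact: term_order_refl veronese_order_term _.
by rewrite /veronese_order E eqxx lt_w.
Qed.

Lemma quadratic_reduction (I : {mpoly K[s]} -> Prop) (M : 'X_{1..s} -> Prop) :
    homogeneous_ideal I ->
    (forall a, M a -> initial_ideal ord I 'X_[a]) ->
    (forall q v, I q -> initial_monomial ord q v ->
       exists2 a, M a & (a <= v)%MM) ->
    (forall a l, M a -> (a l <= e.*2)%N) ->
  forall p w, I (beta_map p) -> initial_monomial veronese_order p w ->
  exists g w' k, [/\ I (beta_map g), (k <= 2)%N, g \is k.-homog,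
                     initial_monomial veronese_order g w' & (w' <= w)%MM].
Proof.
move=> homI MI inM M_le p w Ip pw.
have [wmax|] := classic (pairwise_maximal e beta w); last first.
  (* Extract a quadratic divisor of [w] and a heavier monomial with the same image. *)
  move=> nmax; have [k1 nmax1] := not_all_ex_not _ _ nmax.
  have [k2 nmax2] := not_all_ex_not _ _ nmax1.
  have [k12w nmax3] := imply_to_and _ _ nmax2.
  have [w' nmax4] := not_all_ex_not _ _ nmax3.
  have [w'E /negP] := imply_to_and _ _ nmax4; rewrite -ltnNge => lt_w'.
  have [g0 ghom gin] := initial_binomial w'E lt_w'.
  exists ('X_[U_(k1) + U_(k2)] - 'X_[w']), (U_(k1) + U_(k2))%MM, 2; split=> //.
    by rewrite g0; case: homI => -[].
  by move: ghom; rewrite mdegD !mdeg1.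
have [a Ma aw] := inM _ _ Ip (initial_beta_map wmax pw).
have [w' [w'w w'2 w'a]] :=
  pairwise_maximal_quadratic_divisor d_gt0 le_se_d mdeg_beta beta_surj wmax.
(* Both bounds on [a] enter: it divides [image w], and its exponents are at most [2 e]. *)
have aw' : (a <= image w')%MM.
  apply/mnm_lepP => l; apply: leq_trans (w'a l).
  by rewrite leq_min M_le // andbT; apply/mnm_lepP.
have [q [Iq hq qw']] := initial_ideal_homog ord_term homI (MI _ Ma) aw'.
rewrite (mdeg_mnm_image mdeg_beta) in hq.
have [g [gq hg gw']] := exists_beta_map_lift hq qw'.
by exists g, w', (mdeg w'); rewrite gq.
Qed.

End VeronesePolynomials.

Local Close Scope ring_scope.

(** * Specialization to the enumeration of all vectors of degree [d] *)

Theorem mainTheorem2 (K : fieldType) (s : nat)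
    (I : {mpoly K[s]} -> Prop) (hI : homogeneous_ideal I)
    (ord : rel 'X_{1..s}) (hord : term_order ord)
    (gens : seq 'X_{1..s})
    (hgens : minimal_monomial_generators gens (initial_ideal ord I))
    (d : nat) (hd : (0 < d)%N)
    (hbound : ((s * ((\max_(a <- gens) \max_(j < s) a j) + 1))%:R / 2%:R
                 <= d%:R :> rat)%R) :
  admits_quadratic_groebner_basis
    (fun f : veronese_ring K s d => I (veronese_map f)).
Proof.
(* Rounding [m / 2] up gives [m <= 2 e], while [2 e <= m + 1] turns the bound on [d] into
   [s * e <= d]. *)
set m := (\max_(a <- gens) _) in hbound; pose e := uphalf m.
have le_se_d : (s * e <= d)%N.
  have le_sm : (s * (m + 1) <= d * 2)%N.
    by rewrite -(Num.Theory.ler_nat rat) (natrM _ d); lra.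
  have le_e : (e * 2 <= m + 1)%N by rewrite /e; lia.
  rewrite -(leq_pmul2r (m := 2)) // -mulnA; apply: leq_trans le_sm.
  by rewrite leq_mul2l le_e orbT.
have gens_le a l : a \in gens -> (a l <= e.*2)%N.
  move=> ag; have : (a l <= m)%N.
    apply: leq_trans (leq_bigmax_seq _ ag isT).
    exact: (leq_bigmax_cond (F := fun j => a j)).
  by rewrite /e; lia.
pose beta (k : 'I_#|exponents_of_degree s d|) : 'X_{1..s} := val (enum_val k).
have mdeg_beta k : mdeg (beta k) = d.
  by have := enum_valP k; rewrite inE => /eqP.
have beta_inj : injective beta by move=> k k' /val_inj/enum_val_inj.
have beta_surj b : mdeg b = d -> exists k, beta k = b.
  move=> bd; have lt_b : (mdeg b < d.+1)%N by rewrite bd.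
  have bin : BMultinom lt_b \in exponents_of_degree s d by rewrite inE /= bd.
  by exists (enum_rank_in bin (BMultinom lt_b)); rewrite /beta enum_rankK_in.
case: hgens => _ gen_in _.
have MI a : a \in gens -> initial_ideal ord I 'X_[a].
  by move=> ag; apply/gen_in; apply: sub_ideal_span; exists a.
have inM q v : I q -> initial_monomial ord q v ->
    exists2 a, a \in gens & (a <= v)%MM.
  move=> Iq qv; have /gen_in : initial_ideal ord I 'X_[v].
    by apply: sub_ideal_span; exists q, v.
  by apply: ideal_span_mpolyX.
have order := veronese_order_term e hd mdeg_beta hord.
have reduce := quadratic_reduction hd le_se_d mdeg_beta beta_inj beta_surj hord
  hI MI inM gens_le.
have [G basisG homG] := exists_groebner_basis (D := 2)
  (J := fun f : veronese_ring K s d => I (veronese_map f)) reduce.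
by exists (veronese_order e beta ord), G.
Qed.
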